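(* Consider the system, for $i=1,\dots,N$ and $t\ge 0$, $$x_i'(t)=-d_i(t,x_i(t))+\sum_{l=1,\,l\ne i}^{N} b_{i,l}(t,x_l(t))+\sum_{j=1}^{k}p_{i,j}(t)\,f(x_i(t-\tau_j))-H_i(t,x(t)),$$ with the standing assumptions given in the context. Assume that there exists $c>0$ such that $\sum_{j=1}^{k}p_{i,j}(t)\ge c$ for all $t\ge0$ and $i=1,\dots,N$, and that $$\frac{G_i(t,x)}{x_i}\ \ge\ \sum_{l=1,\,l\neq i}^{N}\frac{b_{i,l}(t,x_l)}{x_l}+\sum_{j=1}^{k}p_{i,j}(t),\qquad i=1,\dots,N,$$ for all $t\ge 0$ and all $x\in(0,+\infty)^N$. Then every positive solution $x$ of the system with initial data $\varphi>0$ (all components positive on $[-\tau^*,0]$) tends to $0$ as $t\to+\infty$.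
   Context: $N,k\ge 1$ are integers, $\tau_1,\dots,\tau_k>0$ are delays, $\tau^*=\max_j\tau_j$, and $f(y):=ye^{-y}$. The functions $d_i,b_{i,l}:[0,+\infty)\times[0,+\infty)\to[0,+\infty)$, $H_i:[0,+\infty)\times[0,+\infty)^N\to[0,+\infty)$ and $p_{i,j}:[0,+\infty)\to[0,+\infty)$ are continuous and nonnegative (possibly nonlinear). Set $G_i(t,x):=d_i(t,x_i)+H_i(t,x)$ for $x=(x_1,\dots,x_N)$; it is assumed that each quotient $G_i(t,x)/x_i$ is bounded from above (over $t\ge0$ and $x\in[0,+\infty)^N$ with $x_i>0$). A solution with initial data $\varphi\in C([-\tau^*,0],[0,+\infty)^N)$ is a continuous function $x:[-\tau^*,+\infty)\to[0,+\infty)^N$ with $x=\varphi$ on $[-\tau^*,0]$ that satisfies the system for $t\ge0$; it is positive if all its components are positive. *)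

(* Defs.v *)
From HB Require Import structures.
From mathcomp Require Import all_boot all_order all_algebra.
From mathcomp Require Import all_classical all_reals all_analysis.
Set Implicit Arguments.
Unset Strict Implicit.
Unset Printing Implicit Defensive.
Import Order.TTheory GRing.Theory Num.Theory.
Import numFieldNormedType.Exports.
Local Open Scope classical_set_scope.
Local Open Scope ring_scope.

(* A function on a closed subset A of a space T is represented by a total
   function on T, about which nothing is assumed outside A. *)

Definition continuous_nonneg_on (R : realType) (T : topologicalType)
    (A : set T) (g : T -> R) : Prop :=
  {within A, continuous g} /\ (forall z, A z -> 0 <= g z).

Definition half_line (R : realType) : set R := [set t | 0 <= t].

Definition orthant (R : realType) (N : nat) : set 'rV[R]_N :=
  [set x | forall i, 0 <= x 0 i].

Definition ricker (R : realType) (y : R) : R := y * expR (- y).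

Section System.
Variables (R : realType) (N k : nat).
Variables (tau : 'I_k -> R) (d : 'I_N -> R -> R -> R).
Variables (b : 'I_N -> 'I_N -> R -> R -> R) (H : 'I_N -> R -> 'rV[R]_N -> R).
Variable p : 'I_N -> 'I_k -> R -> R.

(* The base point 0 of the iterated maximum is harmless: the delays are
   positive. *)
Definition max_delay : R := \big[Num.max/0]_(j < k) tau j.

Definition loss (i : 'I_N) (t : R) (x : 'rV[R]_N) : R :=
  d i t (x 0 i) + H i t x.

Definition system_rhs (x : R -> 'rV[R]_N) (i : 'I_N) (t : R) : R :=
  - d i t (x t 0 i) + \sum_(l < N | l != i) b i l t (x t 0 l)
  + \sum_(j < k) p i j t * ricker (x (t - tau j) 0 i) - H i t (x t).

(* At t = 0 the derivative is the right derivative. *)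
Definition satisfies_system (x : R -> 'rV[R]_N) : Prop :=
  forall i : 'I_N,
    ((h^-1 * (x h 0 i - x 0 0 i)) @[h --> 0^'+] --> system_rhs x i 0) /\
    (forall t : R, 0 < t -> is_derive t 1 (fun s : R => x s 0 i) (system_rhs x i t)).

Definition initial_data (phi : R -> 'rV[R]_N) : Prop :=
  {within `[- max_delay, 0], continuous phi} /\
  (forall t : R, - max_delay <= t <= 0 -> orthant (phi t)).

Definition solution (phi x : R -> 'rV[R]_N) : Prop :=
  [/\ {within [set t | - max_delay <= t], continuous x},
      forall t : R, - max_delay <= t -> orthant (x t),
      forall t : R, - max_delay <= t <= 0 -> x t = phi t
    & satisfies_system x].

End System.

(* Main.v *)
(* Since y e^(-y) <= y/(1+y), a delayed state bounded by s contributes at most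
   g = s/(1+s) < s to the birth term. When x_i(t) is the largest component, the
   domination hypothesis absorbs the coupling terms and gives
   x_i' <= - c (x_i - g). A first-crossing argument then keeps every component
   below a barrier decaying exponentially from s to any eta in ]g, s[. Hence a
   bound s eventually improves to s/(1 + s/2), that is, 1/s grows by 1/2;
   iterating gives convergence to 0. *)
Require Import Defs.
From HB Require Import structures.
From mathcomp Require Import all_boot all_order all_algebra.
From mathcomp Require Import all_classical all_reals all_analysis.
From mathcomp Require Import ring lra.
Set Implicit Arguments.
Unset Strict Implicit.
Unset Printing Implicit Defensive.
Import Order.TTheory GRing.Theory Num.Theory.
Import numFieldNormedType.Exports.
Local Open Scope classical_set_scope.
Local Open Scope ring_scope.

(** * Derivative sign at a left maximum, first crossings, and the Ricker bound *)

Lemma derive_left_max_ge0 (R : realFieldType) (f : R -> R) (a t D : R) :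
  a < t -> is_derive t 1 f D -> (forall s, a <= s < t -> f s <= f t) -> 0 <= D.
Proof.
move=> lt_at df fle.
have dft : derivable f t 1 by [].
(* The derivative is the left-hand limit of difference quotients, each a product of two nonpositive
   factors. *)
rewrite -(@derive_val _ _ _ _ _ _ _ df) [X in _ <= X]cvg_at_leftE//.
apply: limr_ge.
  rewrite -(cvg_at_leftE (fun h => h^-1 *: ((f \o shift t) _ - f t)))//.
  apply: cvg_trans dft; apply: cvg_app.
  by move=> A [e e0 Ae]; exists e => // x xe x0; apply: Ae => //; exact/ltr0_neq0.
near=> h; apply: mulr_le0.
  by rewrite invr_le0; apply: ltW; near: h; exists 1 => /=.
rewrite subr_le0 [_%:A]mulr1; apply: fle.
have h0 : h < 0 by near: h; exists 1 => /=.
have : a - t < h by near: h; apply: nbhs_left_gt; rewrite subr_lt0.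
by rewrite ltrBlDr => /ltW -> /=; rewrite gtrDr.
Unshelve. all: by end_near. Qed.

(** At the infimum [t0] of the times when some component is nonnegative, that component vanishes and
    reaches a maximum from the left, so its derivative cannot be negative. The derivative condition
    may assume negativity on all of [[T, t)], which makes it usable with delayed terms. *)
Lemma first_crossing (R : realType) (I : finType) (w : I -> R -> R) (T : R) :
  (forall i t, T <= t -> {for t, continuous (w i)}) ->
  (forall i, w i T < 0) ->
  (forall i t, T < t -> (forall j s, T <= s < t -> w j s < 0) ->
     (forall j, w j t <= 0) -> w i t = 0 ->
     exists2 D : R, is_derive t 1 (w i) D & D < 0) ->
  forall i t, T <= t -> w i t < 0.
Proof.
move=> wc wT dw i0 t1 Tt1; rewrite ltNge; apply/negP => wt1.
pose S := [set t | T <= t /\ exists i, 0 <= w i t].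
have S0 : S !=set0 by exists t1; split=> //; exists i0.
have Slb : has_lbound S by exists T => t [].
pose t0 := inf S.
have Tt0 : T <= t0 by apply: lb_le_inf => // t [].
have below j s : T <= s < t0 -> w j s < 0.
  move=> /andP[Ts]; rewrite !ltNge; apply: contra => ws.
  by apply: (ge_inf Slb); split=> //; exists j.
(* Otherwise, [I] being finite, all components stay negative on a common neighbourhood of [t0],
   which contradicts the infimum. *)
have [i wi0] : exists i, 0 <= w i t0.
  apply: contrapT => /forallNP w0.
  have : \forall t \near t0, forall i, w i t < 0.
    have H i : \forall t \near t0, w i t < 0.
      by apply: (cvgr_lt _ (wc i t0 Tt0)); rewrite ltNge; exact/negP/w0.
    exact: filter_forall H.
  move=> /nbhs_ballP[e /= e0 we].
  have [|t [Tt [i wit]] tlt] := @inf_lt _ S (t0 + e) S0; first by rewrite ltrDl.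
  have t0t : t0 <= t by apply: (ge_inf Slb); split=> //; exists i.
  suff /(_ i) : forall i, w i t < 0 by rewrite ltNge wit.
  by apply: we; rewrite /ball/= distrC ger0_norm ?subr_ge0// ltrBlDl.
have {}Tt0 : T < t0.
  rewrite lt_neqAle Tt0 andbT; apply/eqP => Te.
  by have := wT i; rewrite Te ltNge wi0.
have wle j : w j t0 <= 0.
  rewrite leNgt; apply/negP => wj0.
  have /cvgr_gt/(_ 0 wj0) := wc j t0 (ltW Tt0).
  move=> /nbhs_ballP[e /= e0 we].
  (* A time just before [t0], clipped at [T] so that [below] applies. *)
  pose s := Num.max T (t0 - e / 2).
  have st0 : s < t0 by rewrite gt_max Tt0/= ltrBlDr ltrDl divr_gt0.
  have sT : T <= s by rewrite le_max lexx.
  have se : t0 - e / 2 <= s by rewrite le_max lexx orbT.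
  have : 0 < w j s by apply: we; rewrite /ball/= ger0_norm; lra.
  by rewrite ltNge ltW// below// sT.
have w0 : w i t0 = 0 by apply/le_anti; rewrite wle wi0.
have [D dwi D0] := dw i t0 Tt0 below wle w0.
suff : 0 <= D by rewrite leNgt D0.
apply: (derive_left_max_ge0 Tt0 dwi) => s st0.
by rewrite w0 ltW// below.
Qed.

Lemma ricker_le (R : realType) (s y : R) :
  0 <= y <= s -> ricker y <= s / (1 + s).
Proof.
move=> /andP[y0 ys].
have s1 : 0 < 1 + s by lra.
rewrite /ricker expRN ler_pdivlMr// mulrAC ler_pdivrMr ?expR_gt0//.
(* [y * (1 + s) <= s * (1 + y)] is just [y <= s]; then [1 + y <= expR y]. *)
apply: (@le_trans _ _ (s * (1 + y))); first nra.
by rewrite ler_wpM2l ?expR_ge1Dx//; lra.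
Qed.

(** * Decay of a positive solution *)

Section Decay.
Variables (R : realType) (N k : nat) (tau : 'I_k -> R).
Variables (d : 'I_N -> R -> R -> R) (b : 'I_N -> 'I_N -> R -> R -> R).
Variables (H : 'I_N -> R -> 'rV[R]_N -> R) (p : 'I_N -> 'I_k -> R -> R).
Variables (c : R) (x : R -> 'rV[R]_N).
Hypothesis k_gt0 : (0 < k)%N.
Hypothesis tau_gt0 : forall j, 0 < tau j.
Hypothesis b_ge0 : forall i l (t y : R), l != i -> 0 <= t -> 0 <= y -> 0 <= b i l t y.
Hypothesis p_ge0 : forall i j (t : R), 0 <= t -> 0 <= p i j t.
Hypothesis c_gt0 : 0 < c.
Hypothesis p_ge : forall (t : R) i, 0 <= t -> c <= \sum_(j < k) p i j t.
Hypothesis loss_dominates : forall (i : 'I_N) (t : R) (y : 'rV[R]_N),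
  0 <= t -> (forall l, 0 < y 0 l) ->
  \sum_(l < N | l != i) b i l t (y 0 l) / y 0 l + \sum_(j < k) p i j t
  <= loss d H i t y / y 0 i.
Hypothesis x_gt0 : forall (t : R) i, - max_delay tau <= t -> 0 < x t 0 i.
Hypothesis x_cont : {within [set t | - max_delay tau <= t], continuous x}.
Hypothesis x_sys : satisfies_system tau d b H p x.

Lemma tau_le_max_delay j : tau j <= max_delay tau.
Proof. exact: (le_bigmax _ tau). Qed.

Lemma max_delay_ge0 : 0 <= max_delay tau.
Proof. exact: bigmax_ge_id. Qed.

(** Multiply the domination inequality by [x_i]: since [x_i >= x_l], each coupling term is at most
    its share of the loss. What remains is at most [- P * (x_i - g)], where [P >= c] and
    [x_i >= g]. *)
Lemma system_rhs_le (t g : R) (i : 'I_N) :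
  0 <= t -> (forall l, x t 0 l <= x t 0 i) -> g <= x t 0 i ->
  (forall j, ricker (x (t - tau j) 0 i) <= g) ->
  system_rhs tau d b H p x i t <= - c * (x t 0 i - g).
Proof.
move=> t0 xmax gx fg.
have tD : - max_delay tau <= t by have := max_delay_ge0; lra.
have xi0 := x_gt0 i tD.
have := @loss_dominates i t (x t) t0 (fun l => x_gt0 l tD).
rewrite ler_pdivlMr// mulrDl mulr_suml /system_rhs /loss.
set P := \sum_(j < k) p i j t => dom.
have bE : \sum_(l < N | l != i) b i l t (x t 0 l) <=
    \sum_(l < N | l != i) b i l t (x t 0 l) / x t 0 l * x t 0 i.
  apply: ler_sum => l li; have xl0 := x_gt0 l tD.
  rewrite mulrAC ler_pdivlMr// ler_wpM2l// b_ge0//; exact: ltW.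
have pE : \sum_(j < k) p i j t * ricker (x (t - tau j) 0 i) <= P * g.
  by rewrite mulr_suml; apply: ler_sum => j _; rewrite ler_wpM2l// p_ge0.
have := p_ge i t0; rewrite -/P => cP.
have : 0 <= (P - c) * (x t 0 i - g) by apply: mulr_ge0; lra.
lra.
Qed.

Lemma state_continuous t i : 0 <= t ->
  {for t, continuous (fun s => x s 0 i)}.
Proof.
move=> t0.
(* A positive maximal delay puts [t = 0] in the interior of the domain, so continuity is two-sided
   there too. *)
have D0 : 0 < max_delay tau.
  exact: lt_le_trans (tau_gt0 (Ordinal k_gt0)) (tau_le_max_delay _).
have xt : {for t, continuous x}.
  have h : t \in (`]- max_delay tau, t + 1[ : interval R).
    by rewrite in_itv/=; apply/andP; split; lra.
  apply: (within_continuous_continuous _ _ h); first lra.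
  apply: continuous_subspaceW x_cont => s /=.
  by rewrite in_itv/= => /andP[].
exact: (continuous_comp xt (@coord_continuous _ _ _ _ _ _)).
Qed.

(** The barrier solves [B' = - c * (B - eta)], while a component touching it has slope at most
    [- c * (B - g)], smaller by [c * (eta - g) > 0]. The Ricker hypothesis may use the bound [A] on
    [[T, t)], so the lemma can also establish that bound. *)
Lemma barrier (T A eta g : R) : 0 <= T -> g < eta -> eta <= A ->
  (forall l, x T 0 l < A) ->
  (forall t i j, T < t -> (forall s l, T <= s < t -> x s 0 l < A) ->
     ricker (x (t - tau j) 0 i) <= g) ->
  forall t l, T <= t -> x t 0 l < eta + (A - eta) * expR (- c * (t - T)).
Proof.
move=> T0 geta etaA xT fg t l Tt.
pose B s := eta + (A - eta) * expR (- c * (s - T)).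
have dB (s : R) : is_derive s (1 : R) B (- c * (B s - eta)).
  rewrite /B; apply: is_derive_eq.
  rewrite /GRing.scale/=; ring.
have etaB s : eta <= B s.
  by rewrite lerDl mulr_ge0 ?expR_ge0// subr_ge0.
rewrite -subr_lt0.
apply: (@first_crossing _ _ (fun i s => x s 0 i - B s) T) => //.
- move=> i s Ts; apply: (@cvgB _ R).
    by apply: state_continuous => //; exact: le_trans Ts.
  by apply: differentiable_continuous; apply/derivable1_diffP; have [] := dB s.
- by move=> i; rewrite /B subrr mulr0 expR0 mulr1 subrKC subr_lt0.
move=> i s Ts below xle xi.
have s0 : 0 < s by exact: le_lt_trans Ts.
have xiB : x s 0 i = B s by apply/eqP; rewrite -subr_eq0 xi.
(* [B <= A] after [T], so lying below the barrier gives the bound [A] that [fg] requires. *)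
have fgs j : ricker (x (s - tau j) 0 i) <= g.
  apply: fg => // r m /andP[Tr rs].
  have /below : T <= r < s by rewrite Tr.
  move=> /(_ m); rewrite subr_lt0 => /lt_le_trans; apply.
  rewrite /B -lerBrDl ler_piMr ?subr_ge0// -expR0 ler_expR mulNr oppr_le0.
  by rewrite mulr_ge0 ?subr_ge0// ltW.
exists (system_rhs tau d b H p x i s - - c * (B s - eta)).
  apply: is_deriveB; exact: (x_sys i).2.
have xmax m : x s 0 m <= x s 0 i by have := xle m; rewrite subr_le0 xiB.
have gB : g <= x s 0 i by rewrite xiB; apply: le_trans (etaB s); exact: ltW.
have := system_rhs_le (ltW s0) xmax gB fgs.
rewrite xiB => rhs.
have : 0 < c * (eta - g) by rewrite mulr_gt0 ?subr_gt0.
lra.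
Qed.

Lemma state_bounded :
  exists2 s : R, 0 < s & forall t l, - max_delay tau <= t -> x t 0 l < s.
Proof.
have D0 := max_delay_ge0.
have D0' : - max_delay tau <= 0 by lra.
have hist l : exists M : R, forall t, - max_delay tau <= t <= 0 -> x t 0 l <= M.
  have [|r _ rmax] := @EVT_max R (fun s => x s 0 l) _ _ D0'.
    have xc : {within `[- max_delay tau, 0], continuous x}.
      by apply: continuous_subspaceW x_cont => s /=; rewrite in_itv/= => /andP[].
    by move=> s; exact: (continuous_comp (xc s) (@coord_continuous _ _ _ _ _ _)).
  by exists (x r 0 l) => t tD; apply: rmax; rewrite in_itv.
have [M xM] := choice hist.
(* Adding 1 makes the bound strict. *)
pose s := 1 + \big[Num.max/0]_l M l.
have s0 : 0 < s by rewrite ltr_pwDl// bigmax_ge_id.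
have xs t l : - max_delay tau <= t <= 0 -> x t 0 l < s.
  move=> tD; apply: (le_lt_trans (xM l t tD)).
  by apply: (le_lt_trans (le_bigmax 0 M l)); rewrite /s ltrDr.
exists s => // t l tD.
have [t0|/ltW t0] := leP t 0; first by apply: xs; rewrite tD t0.
(* The barrier lemma with A = eta is the constant barrier. *)
suff : x t 0 l < s + (s - s) * expR (- c * (t - 0)).
  by rewrite subrr mul0r addr0.
apply: (@barrier 0 s s (s / (1 + s))) => //.
- by rewrite ltr_pdivrMr; nra.
- by move=> m; apply: xs; rewrite D0' lexx.
move=> r i j r0 below; apply: ricker_le.
have tj := tau_gt0 j; have tjD := tau_le_max_delay j.
have rD : - max_delay tau <= r - tau j by lra.
apply/andP; split; first exact/ltW/x_gt0.
(* The delayed time lies either in the initial history or in [[0, r)], where [below] holds. *)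
have [r0'|/ltW r0'] := leP (r - tau j) 0.
  by apply/ltW/xs; rewrite rD.
by apply/ltW/below; rewrite r0'/=; lra.
Qed.

Lemma state_bound_improves (s T : R) : 0 < s -> 0 <= T ->
  (forall t l, T <= t -> x t 0 l < s) ->
  exists2 T' : R, T <= T' & forall t l, T' <= t -> x t 0 l < s / (1 + s / 2).
Proof.
move=> s0 T0 xs.
have D0 := max_delay_ge0.
(* [eta] lies strictly between [g] and [q]: above [g] for the barrier lemma, below [q] so that the
   barrier reaches [q] in finite time. *)
pose g := s / (1 + s); pose q := s / (1 + s / 2); pose eta := (g + q) / 2.
have gq : g < q.
  by rewrite /g /q ltr_pM2l// ltf_pV2 ?posrE; lra.
have qs : q <= s by rewrite /q ler_pdivrMr; nra.
have gE : g < eta by rewrite /eta; lra.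
have Eq : eta < q by rewrite /eta; lra.
(* The barrier is at most [q] once its exponent [u] satisfies [expR u >= z]; as [expR u >= 1 + u],
   [u >= z] suffices, hence the waiting time [z / c]. The extra [max_delay tau] keeps all delayed
   times after [T]. *)
pose z := (s - eta) / (q - eta).
have z0 : 0 <= z by apply: divr_ge0; lra.
have zc0 : 0 <= z / c by rewrite divr_ge0// ltW.
exists (T + max_delay tau + z / c) => [|t l tT]; first lra.
have xb : x t 0 l <
    eta + (s - eta) * expR (- c * (t - (T + max_delay tau))).
  apply: (@barrier _ _ _ g) => //; [lra|lra| |..|lra].
    by move=> m; apply: xs; lra.
  move=> r i j rT _; apply: ricker_le.
  have tj := tau_gt0 j; have tjD := tau_le_max_delay j.
  apply/andP; split; first by apply/ltW/x_gt0; lra.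
  by apply/ltW/xs; lra.
apply: (lt_le_trans xb); rewrite -/q -lerBrDl.
have zt : z <= c * (t - (T + max_delay tau)).
  by rewrite mulrC -ler_pdivrMr// lerBrDl.
rewrite mulNr expRN ler_pdivrMr ?expR_gt0//.
have -> : s - eta = (q - eta) * z.
  by rewrite /z mulrC divfK// subr_eq0 gt_eqF.
rewrite ler_wpM2l//; first lra.
by apply: (le_trans zt); apply: le_trans (expR_ge1Dx _); rewrite lerDr.
Qed.

Lemma state_bound_iterated : exists2 a : R, 0 < a & forall n : nat,
  exists2 T : R, 0 <= T & forall t l, T <= t -> x t 0 l < (a + n%:R / 2)^-1.
Proof.
have [s s0 xs] := state_bounded.
exists s^-1; first by rewrite invr_gt0.
elim=> [|n [T T0 xT]].
  exists 0 => // t l t0; rewrite mul0r addr0 invrK; apply: xs.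
  by have := max_delay_ge0; lra.
have r0 : 0 < s^-1 + n%:R / 2 by rewrite ltr_wpDr ?invr_gt0// divr_ge0.
have q0 : 0 < (s^-1 + n%:R / 2)^-1 by rewrite invr_gt0.
have [T' TT' xT'] := state_bound_improves q0 T0 xT.
exists T' => [|t l tT']; first exact: le_trans TT'.
have -> : (s^-1 + n.+1%:R / 2)^-1 =
    (s^-1 + n%:R / 2)^-1 / (1 + (s^-1 + n%:R / 2)^-1 / 2).
  rewrite -invfM mulrDr mulr1 mulrA divff ?gt_eqF// -natr1; congr (_^-1); lra.
exact: xT'.
Qed.

Lemma state_cvg0 : x t @[t --> +oo] --> (0 : 'rV[R]_N).
Proof.
have [a a0 xa] := state_bound_iterated.
apply/cvg_ballP => e e0.
(* This index exceeds [2 / e], so the bound's reciprocal exceeds [1 / e]. *)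
have [T T0 xT] := xa (Num.truncn (2 / e)).+1.
exists T; split; first exact: num_real.
move=> t /= Tt; split=> // i j; rewrite mxE ord1 /ball/= sub0r normrN.
have xj0 : 0 < x t 0 j by apply: x_gt0; have := max_delay_ge0; lra.
rewrite gtr0_norm//; apply: (lt_trans (xT t j (ltW Tt))).
rewrite invf_plt ?posrE//; last by rewrite ltr_wpDr// divr_ge0.
have := truncnS_gt (2 / e).
set n := _%:R; rewrite -(mulrC e^-1) => en; lra.
Qed.

End Decay.

Theorem theorem4 (R : realType) (N k : nat) (hN : (1 <= N)%N) (hk : (1 <= k)%N)
    (tau : 'I_k -> R) (htau : forall j, 0 < tau j)
    (d : 'I_N -> R -> R -> R) (b : 'I_N -> 'I_N -> R -> R -> R)
    (H : 'I_N -> R -> 'rV[R]_N -> R) (p : 'I_N -> 'I_k -> R -> R)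
    (hd : forall i, continuous_nonneg_on (@half_line R `*` @half_line R)
                      (fun z : R * R => d i z.1 z.2))
    (hb : forall i l, l != i ->
            continuous_nonneg_on (@half_line R `*` @half_line R)
              (fun z : R * R => b i l z.1 z.2))
    (hH : forall i, continuous_nonneg_on (@half_line R `*` @orthant R N)
                      (fun z : R * 'rV[R]_N => H i z.1 z.2))
    (hp : forall i j, continuous_nonneg_on (@half_line R) (p i j))
    (hG : forall i, exists K : R, forall (t : R) (x : 'rV[R]_N),
            0 <= t -> orthant x -> 0 < x 0 i -> loss d H i t x / x 0 i <= K)
    (hc : exists c : R, 0 < c /\
            forall (t : R) i, 0 <= t -> c <= \sum_(j < k) p i j t)
    (hdom : forall (i : 'I_N) (t : R) (x : 'rV[R]_N),
              0 <= t -> (forall l, 0 < x 0 l) ->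
              \sum_(l < N | l != i) b i l t (x 0 l) / x 0 l
                + \sum_(j < k) p i j t
              <= loss d H i t x / x 0 i)
    (phi : R -> 'rV[R]_N) (hphi : initial_data tau phi)
    (hphi_pos : forall (t : R) i, - max_delay tau <= t <= 0 -> 0 < phi t 0 i)
    (x : R -> 'rV[R]_N) (hx : solution tau d b H p phi x)
    (hx_pos : forall (t : R) i, - max_delay tau <= t -> 0 < x t 0 i) :
  x t @[t --> +oo] --> (0 : 'rV[R]_N).
Proof.
have [c [c0 pc]] := hc.
have [xc _ _ xsys] := hx.
apply: (@state_cvg0 R N k tau d b H p c) => //.
- by move=> i l t y li t0 y0; exact: (hb i l li).2 (t, y) (conj t0 y0).
- by move=> i j t t0; exact: (hp i j).2.
Qed.
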